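(* For every integer $l \ge 1$, the domination numbers of the fractal cubic networks satisfy $\gamma(FCN(l)) = 4\,\gamma(FCN(l-1)) - 2$.
   Context: Fractal cubic network: for an integer $l\ge 0$, $FCN(l)$ is the finite simple graph whose vertices are all binary strings of length $2l+2$, defined recursively as follows. $FCN(0)$ is the 4-cycle with vertices $00, 01, 11, 10$ in this cyclic order. For $l\ge 1$, $FCN(l)$ is obtained from the disjoint union of the four copies $ab\,\Vert\,FCN(l-1)$, $a,b\in\{0,1\}$ (each vertex string of $FCN(l-1)$ is prefixed by $ab$, adjacency inside a copy being that of $FCN(l-1)$), by adding the four edges $\{00w,10w\}$, $\{10w,11w\}$, $\{11w,01w\}$, $\{01w,00w\}$, where $w=10(01)^{l-1}$ is the string $10$ followed by $l-1$ repetitions of $01$. A dominating set of a graph $\Gamma$ is a set $D\subseteq V(\Gamma)$ such that every vertex of $\Gamma$ is in $D$ or adjacent to a vertex of $D$; $\gamma(\Gamma)$ is the minimum size of a dominating set. *)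

(* Defs.v *)
From mathcomp Require Import all_boot.

Set Implicit Arguments.
Unset Strict Implicit.
Unset Printing Implicit Defensive.

Record sgraph := SGraph {
  vertex :> finType;
  adj : rel vertex;
  adj_sym : symmetric adj;
  adj_irrefl : irreflexive adj }.

Definition dominating (G : sgraph) (D : {set G}) : bool :=
  [forall v : G, (v \in D) || [exists u in D, adj u v]].

Lemma dominatingT (G : sgraph) : dominating [set: G].
Proof. by apply/forallP => v; rewrite inE. Qed.

(* The default [set: G] of the argmin is itself dominating (dominatingT), so
   this is the size of a smallest dominating set. *)
Definition domination_number (G : sgraph) : nat :=
  #|[arg min_(D < [set: G] | dominating D) #|D|]|.

Lemma domination_number_min (G : sgraph) (D : {set G}) :
  dominating D -> domination_number G <= #|D|.
Proof.
rewrite /domination_number; case: arg_minnP => [|D0 _ minD0]; last exact: minD0.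
exact: dominatingT.
Qed.

Lemma domination_number_witness (G : sgraph) :
  exists2 D : {set G}, dominating D & #|D| = domination_number G.
Proof.
rewrite /domination_number; case: arg_minnP => [|D0 domD0 _]; last by exists D0.
exact: dominatingT.
Qed.

(* The bits 0 and 1 of a binary string are false and true. The cycle
   00 - 01 - 11 - 10 - 00 gives both FCN(0) and, read on the two-bit prefixes,
   the four edges {00w,10w}, {10w,11w}, {11w,01w}, {01w,00w}. *)
Definition C4_edges : seq (seq bool * seq bool) :=
  [:: ([:: false; false], [:: false; true]);
      ([:: false; true], [:: true; true]);
      ([:: true; true], [:: true; false]);
      ([:: true; false], [:: false; false])].

Definition C4_adj : rel (seq bool) :=
  fun u v => ((u, v) \in C4_edges) || ((v, u) \in C4_edges).

(* 10(01)^k *)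
Definition fcn_link (k : nat) : seq bool :=
  [:: true; false] ++ flatten (nseq k [:: false; true]).

Lemma size_fcn_link k : size (fcn_link k) = 2 * k + 2.
Proof. by rewrite /fcn_link; elim: k => //= k ->; rewrite mulnS. Qed.

(* Meaningful on strings of length 2 * l + 2 only. *)
Fixpoint fcn_adj (l : nat) : rel (seq bool) :=
  if l is k.+1 then
    fun u v =>
      (take 2 u == take 2 v) && fcn_adj k (drop 2 u) (drop 2 v)
      || [&& drop 2 u == fcn_link k, drop 2 v == fcn_link k
           & C4_adj (take 2 u) (take 2 v)]
  else C4_adj.

Lemma C4_adj_sym : symmetric C4_adj.
Proof. by move=> u v; rewrite /C4_adj orbC. Qed.

Lemma C4_adj_irrefl : irreflexive C4_adj.
Proof.
move=> u; apply/negbTE; rewrite /C4_adj orbb !inE !xpair_eqE.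
by apply/negP => /or4P[] /andP[/eqP->].
Qed.

Lemma fcn_adj_sym l : symmetric (fcn_adj l).
Proof.
elim: l => [|l IHl] u v; first exact: C4_adj_sym.
by rewrite /= eq_sym IHl C4_adj_sym; congr (_ || _); rewrite andbCA.
Qed.

Lemma fcn_adj_irrefl l : irreflexive (fcn_adj l).
Proof.
elim: l => [|l IHl] u; first exact: C4_adj_irrefl.
by rewrite /= IHl C4_adj_irrefl !andbF.
Qed.

Definition FCN (l : nat) : sgraph :=
  @SGraph ((2 * l + 2).-tuple bool) (fun u v => fcn_adj l u v)
    (fun u v => fcn_adj_sym l u v) (fun u => fcn_adj_irrefl l u).

(* Main.v *)
(** Let [w] be the link vertex of [FCN l] and [g] its domination number. A set
    missing at most [w] has at least [g - 1] elements, and if it has only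
    [g - 1] then it leaves [w] undominated. In a dominating set of
    [FCN l.+1] each copy of [FCN l] whose trace has [g - 1] elements
    therefore needs [w] in the trace of a neighbouring copy, which then has at
    least [g] elements; on a 4-cycle this forces two copies with at least [g],
    so there are at least [4 * g - 2] elements in total.
    The bound is attained because two kinds of sets of size [g - 1] propagate
    from [l] to [l.+1]: [B], missing only [w], and [E], containing [w] and
    missing only the corner [(01)^(l+1)], whose copy in 10||FCN(l) is the next
    link vertex. *)
Require Import Defs.
From mathcomp Require Import all_boot zify.

Set Implicit Arguments.
Unset Strict Implicit.
Unset Printing Implicit Defensive.

(** * Domination by lists of strings *)

(** Lists of raw strings, rather than sets of tuples, let prefixes be added and removed without
    casts on lengths. *)
Definition covers (l : nat) (D : seq (seq bool)) (v : seq bool) : bool :=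
  (v \in D) || has (fun u => fcn_adj l u v) D.

Definition dominates (l : nat) (D : seq (seq bool)) : Prop :=
  forall v, size v = 2 * l + 2 -> covers l D v.

Definition dominates_but (l : nat) (x : seq bool) (D : seq (seq bool)) : Prop :=
  forall v, size v = 2 * l + 2 -> v != x -> covers l D v.

Definition fcn_corner (l : nat) : seq bool :=
  flatten (nseq l.+1 [:: false; true]).

Definition section (D : seq (seq bool)) (p : seq bool) : seq (seq bool) :=
  [seq drop 2 u | u <- D & take 2 u == p].

Lemma C4_adjP q a b :
  C4_adj q [:: a; b] -> q = [:: ~~ a; b] \/ q = [:: a; ~~ b].
Proof.
by case: a; case: b; case: q => [|[] [|[] [|? ?]]] //; auto.
Qed.

Lemma C4_adj_size u v : C4_adj u v -> size u = 2.
Proof.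
by rewrite /C4_adj !inE !xpair_eqE => /orP[] /or4P[] /andP[/eqP ? /eqP ?]; subst.
Qed.

Lemma fcn_adj_size l u v : fcn_adj l u v -> size u = 2 * l + 2.
Proof.
elim: l u v => [|l IHl] u v /=; first exact: C4_adj_size.
case/orP => [/andP[_ /IHl]|/and3P[/eqP/(congr1 size) + _ _]];
  by rewrite ?size_fcn_link size_drop; move: (size _) => n; lia.
Qed.

(** Entries of [D] of the wrong length are harmless: by [fcn_adj_size] they cover no vertex, so [S]
    may leave them out. *)
Lemma domination_number_le l D :
  dominates l D -> domination_number (FCN l) <= size D.
Proof.
move=> domD; pose S : {set FCN l} := [set t | tval t \in D].
have domS : dominating S.
  apply/forallP => t; case/orP: (domD _ (size_tuple t)) => [tD|/hasP[u uD ut]].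
    by rewrite inE tD.
  apply/orP; right; apply/existsP.
  have su := introT eqP (fcn_adj_size ut).
  by exists (Tuple su); rewrite inE uD.
apply: leq_trans (domination_number_min domS) _.
rewrite cardE -(size_map (@tval _ _)); apply: uniq_leq_size.
  by rewrite (map_inj_uniq val_inj) enum_uniq.
by move=> _ /mapP[t + ->]; rewrite mem_enum inE.
Qed.

Lemma dominates_domination_number l :
  exists2 D, dominates l D & size D = domination_number (FCN l).
Proof.
have [S /forallP domS <-] := domination_number_witness (FCN l).
exists (map (@tval _ _) (enum S)); last by rewrite size_map cardE.
move=> v /eqP sv; case/orP: (domS (Tuple sv)) => [vS|/existsP[u /andP[uS uv]]].
  by apply/orP; left; apply/mapP; exists (Tuple sv); rewrite ?mem_enum.
by apply/orP; right; apply/hasP; exists (tval u); rewrite ?map_f ?mem_enum.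
Qed.

Lemma covers_cat l D1 D2 v :
  covers l (D1 ++ D2) v = covers l D1 v || covers l D2 v.
Proof. by rewrite /covers mem_cat has_cat orbACA. Qed.

Lemma coversW l D v : v \in D -> covers l D v.
Proof. by rewrite /covers => ->. Qed.

Lemma covers_cons l x D v : covers l D v -> covers l (x :: D) v.
Proof. by rewrite -cat1s covers_cat => ->; rewrite orbT. Qed.

Lemma dominates_cons l x D : dominates_but l x D -> dominates l (x :: D).
Proof.
move=> domD v sv; have [->|vx] := eqVneq v x; first by exact/coversW/mem_head.
exact/covers_cons/domD.
Qed.

Lemma domination_number_but_le l x D :
  dominates_but l x D -> domination_number (FCN l) <= (size D).+1.
Proof. by move/dominates_cons/domination_number_le. Qed.

(** * Passing between [FCN l.+1] and its four copies *)

Lemma covers_copy l a b D v :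
  covers l D v -> covers l.+1 [seq [:: a, b & u] | u <- D] [:: a, b & v].
Proof.
case/orP => [vD|/hasP[u uD uv]]; apply/orP; [left|right].
  exact: (map_f (fun u => [:: a, b & u])).
apply/hasP; exists [:: a, b & u]; first exact: (map_f (fun u => [:: a, b & u])).
by rewrite /= !drop0 !take0 eqxx uv.
Qed.

Lemma covers_link l a b c d D :
    C4_adj [:: a; b] [:: c; d] -> fcn_link l \in D ->
  covers l.+1 [seq [:: a, b & u] | u <- D] [:: c, d & fcn_link l].
Proof.
move=> ab_cd; move lE: (fcn_link l) => w wD; apply/orP; right; apply/hasP.
exists [:: a, b & w]; first exact: (map_f (fun u => [:: a, b & u])).
by rewrite /= !drop0 !take0 lE !eqxx ab_cd orbT.
Qed.

(** Only the link of a copy has neighbours outside that copy, namely the links of the copies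
    adjacent to it on the 4-cycle. *)
Lemma covers_section l D a b v :
    covers l.+1 D [:: a, b & v] ->
  covers l (section D [:: a; b]) v \/
  v = fcn_link l /\
    exists2 q, C4_adj q [:: a; b] & fcn_link l \in section D q.
Proof.
have in_section u : u \in D -> drop 2 u \in section D (take 2 u).
  by move=> uD; apply: map_f; rewrite mem_filter eqxx.
case/orP => [/in_section|/hasP[u /in_section uD]]; rewrite /= drop0 take0.
  by move=> vD; left; apply: coversW.
case/orP => [/andP[/eqP <- uv]|/and3P[/eqP <- /eqP -> uab]].
  by left; apply/orP; right; apply/hasP; exists (drop 2 u).
by right; split=> //; exists (take 2 u).
Qed.

Lemma size_sections D :
  size (section D [:: false; false]) + size (section D [:: false; true]) +
  size (section D [:: true; true]) + size (section D [:: true; false])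
  <= size D.
Proof.
rewrite !size_map !size_filter; elim: D => //= u D.
by case: u => [|[] [|[] u]] //=; rewrite ?take0 /=; lia.
Qed.

(** * The lower bound *)

Lemma domination_number_ge l :
  4 * domination_number (FCN l) - 2 <= domination_number (FCN l.+1).
Proof.
have [D domD <-] := dominates_domination_number l.+1.
set g := domination_number _.
have covD a b v : size v = 2 * l + 2 -> covers l.+1 D [:: a, b & v].
  by move=> sv; apply: domD; rewrite /= sv; lia.
have butD a b : dominates_but l (fcn_link l) (section D [:: a; b]).
  by move=> v sv vl; case: (covers_section (covD a b v sv)) => // -[vE];
    rewrite vE eqxx in vl.
have sizeD a b := domination_number_but_le (butD a b).
have fullD a b : covers l (section D [:: a; b]) (fcn_link l) ->
    g <= size (section D [:: a; b]).
  move=> covl; apply: domination_number_le => v sv.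
  by have [->//|] := eqVneq v (fcn_link l); apply: butD.
have nbrD a b : [|| g <= size (section D [:: a; b]),
    g <= size (section D [:: ~~ a; b]) | g <= size (section D [:: a; ~~ b])].
  case: (covers_section (covD a b _ (size_fcn_link l))) => [/fullD->//|].
  by case=> _ [q /C4_adjP[] -> lq]; have /fullD-> := coversW l lq; rewrite ?orbT.
have := size_sections D.
move: (sizeD false false) (sizeD false true) (sizeD true true) (sizeD true false).
move: (nbrD false false) (nbrD false true) (nbrD true true) (nbrD true false).
(* By [nbrD] the copies with at least [g] elements dominate the 4-cycle of prefixes, so there are at
   least two; by [sizeD] the others have at least [g - 1]. *)
rewrite -/g /=; lia.
Qed.

(** * The upper bound *)

Definition four_copies (D : bool -> bool -> seq (seq bool)) : seq (seq bool) :=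
  [seq [:: false, false & u] | u <- D false false] ++
  [seq [:: false, true & u] | u <- D false true] ++
  [seq [:: true, true & u] | u <- D true true] ++
  [seq [:: true, false & u] | u <- D true false].

Lemma size_four_copies D :
  size (four_copies D) =
  size (D false false) + size (D false true) +
  size (D true true) + size (D true false).
Proof. by rewrite !size_cat !size_map !addnA. Qed.

Lemma covers_four_copies l D a b v :
    covers l.+1 [seq [:: a, b & u] | u <- D a b] v ->
  covers l.+1 (four_copies D) v.
Proof. by rewrite !covers_cat; case: a; case: b => ->; rewrite ?orbT. Qed.

Lemma dominates_but_four_copies l (x : seq bool) D :
    (forall (a b : bool) (v : seq bool), size v = 2 * l + 2 -> [:: a, b & v] != x ->
      covers l (D a b) v \/
      v = fcn_link l /\
        exists c d, C4_adj [:: c; d] [:: a; b] /\ fcn_link l \in D c d) ->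
  dominates_but l.+1 x (four_copies D).
Proof.
move=> domD [|a [|b v]] sv vx; rewrite /= in sv; try lia.
have {}sv : size (v : seq bool) = 2 * l + 2 by lia.
case: (domD a b v sv vx) => [vD|[-> [c [d [cd_ab lD]]]]].
  exact/covers_four_copies/covers_copy.
exact/covers_four_copies/(covers_link cd_ab).
Qed.

Lemma domination_number_FCN0 : domination_number (FCN 0) = 2.
Proof.
apply/eqP; rewrite eqn_leq; apply/andP; split.
  apply: (@domination_number_le 0 [:: [:: true; false]; [:: false; true]]).
  by move=> [|[] [|[] [|? ?]]].
have [D domD <-] := dominates_domination_number 0.
(* The empty list covers nothing, and a single vertex of the 4-cycle misses its antipode. *)
case: D domD => [|x [|? ?]] // domD; first by have := domD [:: true; true] erefl.
have := domD [:: false; true] erefl; have := domD [:: false; false] erefl.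
have := domD [:: true; false] erefl; have := domD [:: true; true] erefl.
by clear domD; case: x => [|[] [|[] [|? ?]]].
Qed.

Lemma near_dominating_step l (E B : seq (seq bool)) :
    let g := domination_number (FCN l) in
    fcn_link l \in E -> dominates_but l (fcn_corner l) E -> (size E).+1 = g ->
    dominates_but l (fcn_link l) B -> (size B).+1 = g ->
  exists E' B' : seq (seq bool),
    [/\ fcn_link l.+1 \in E', dominates_but l.+1 (fcn_corner l.+1) E',
        size E' = 4 * g - 3, dominates_but l.+1 (fcn_link l.+1) B'
      & size B' = 4 * g - 3].
Proof.
move=> g lE domE sE domB sB.
(* In copies 00 and 11 the link missed by [B] is covered from copy 10. Copy 10 is completed by its
   corner, which is [fcn_link l.+1]; copy 01 misses only its own corner, which is [fcn_corner l.+1].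
   The size is 3(g - 1) + g. *)
pose E' a b := match a, b with
  | false, true => E | true, false => fcn_corner l :: E | _, _ => B end.
(* Now copy 10 misses only its corner [fcn_link l.+1], while its link still covers those of copies
   00 and 11. *)
pose B' a b := match a, b with
  | false, true => fcn_link l :: B | true, false => E | _, _ => B end.
have lcE : fcn_link l \in fcn_corner l :: E by rewrite inE lE orbT.
exists (four_copies E'), (four_copies B'); split.
- rewrite !mem_cat; apply/orP; right; apply/orP; right; apply/orP; right.
  exact/(map_f (fun u => [:: true, false & u]))/mem_head.
- apply: dominates_but_four_copies => a b v sv vx.
  have [v_link|v_nlink] := eqVneq v (fcn_link l).
    case: a b {vx} => [] []; rewrite v_link.
    + by right; split=> //; exists true, false.
    + by left; apply: coversW.
    + by left; apply: coversW.
    + by right; split=> //; exists true, false.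
  left; case: a b vx => [] [] vx; [exact: domB| | |exact: domB].
    exact: (dominates_cons domE).
  by apply: domE => //; apply: contraNneq vx => ->.
- by rewrite size_four_copies /=; lia.
- apply: dominates_but_four_copies => a b v sv vx.
  have [v_link|v_nlink] := eqVneq v (fcn_link l).
    case: a b {vx} => [] []; rewrite v_link.
    + by right; split=> //; exists true, false.
    + by left; apply: coversW.
    + by left; exact/coversW/mem_head.
    + by right; split=> //; exists true, false.
  left; case: a b vx => [] [] vx; [exact: domB| | |exact: domB].
    by apply: domE => //; apply: contraNneq vx => ->.
  exact: (dominates_cons domB).
- by rewrite size_four_copies /=; lia.
Qed.

(** Adding [x] to [D] meets the lower bound exactly; positivity keeps the truncated subtractions
    from losing anything. *)
Lemma domination_number_of_but l x D :
  dominates_but l.+1 x D -> size D = 4 * domination_number (FCN l) - 3 ->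
  0 < domination_number (FCN l) ->
  domination_number (FCN l.+1) = 4 * domination_number (FCN l) - 2.
Proof.
move=> domD sD g_gt0; have := domination_number_but_le domD.
have := domination_number_ge l; lia.
Qed.

(** [E] and [B] go through the induction together, since each of the next two lists is built from
    both. *)
Lemma near_dominating l :
  exists E B : seq (seq bool),
    [/\ fcn_link l \in E, dominates_but l (fcn_corner l) E,
        (size E).+1 = domination_number (FCN l), dominates_but l (fcn_link l) B
      & (size B).+1 = domination_number (FCN l)].
Proof.
elim: l => [|l [E [B [lE domE sE domB sB]]]].
  (* The link 10 and the corner 01 of [FCN 0] are antipodal, so each alone misses only the other. *)
  exists [:: [:: true; false]], [:: [:: false; true]].
  rewrite domination_number_FCN0; split=> //.
    by move=> [|[] [|[] [|? ?]]].
  by move=> [|[] [|[] [|? ?]]].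
have [E' [B' [lE' domE' sE' domB' sB']]] :=
  near_dominating_step lE domE sE domB sB.
exists E', B'; have -> : domination_number (FCN l.+1) = (size E').+1.
  by rewrite (domination_number_of_but domE' sE') ?sE'; lia.
by split=> //; rewrite sB' sE'.
Qed.

Theorem theorem20 (l : nat) (hl : 1 <= l) :
  domination_number (FCN l) = 4 * domination_number (FCN l.-1) - 2.
Proof.
case: l hl => // l _.
have [E [B [lE domE sE domB sB]]] := near_dominating l.
have [E' [_ [_ domE' sE' _ _]]] := near_dominating_step lE domE sE domB sB.
by apply: (domination_number_of_but domE' sE'); rewrite -sE.
Qed.
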